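(* Let $\mathcal{D}$ be a distribution on $\mathcal{X}$, $X\sim\mathcal{D}^n$, and $\sigma>0$. Let $\mathcal{Q}_\sigma$ be the class of functions $\phi:\mathcal{X}^n\to\mathbb{R}$ such that $\phi(X)-\phi(\mathcal{D}^n)$ is $\sigma$-subgaussian, where $\phi(\mathcal{D}^n)=\mathbb{E}_{X'\sim\mathcal{D}^n}[\phi(X')]$. If $\mathcal{M}:\mathcal{X}^n\to\mathcal{Q}_\sigma$ is a randomized mapping with $I(\mathcal{M}(X);X)\le B$, then $$\mathbb{E}_{X\sim\mathcal{D}^n,\ \phi\leftarrow\mathcal{M}(X)}\left[(\phi(X)-\phi(\mathcal{D}^n))^2\right]\le\sigma^2\cdot\inf_{\lambda\in(0,1)}\left(\frac{2B-\ln(1-\lambda)}{\lambda}\right).$$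
   Context: A real random variable $Y$ is $\sigma$-subgaussian if $\mathbb{E}[e^{tY}]\le e^{t^2\sigma^2/2}$ for all $t\in\mathbb{R}$. $I(\cdot;\cdot)$ denotes mutual information measured in nats. *)

(* Defs.v *)
From HB Require Import structures.
From mathcomp Require Import all_boot all_order all_algebra.
From mathcomp Require Import all_classical all_reals all_analysis.
Set Implicit Arguments. Unset Strict Implicit. Unset Printing Implicit Defensive.
Import Order.TTheory GRing.Theory Num.Theory.
Local Open Scope classical_set_scope.
Local Open Scope ring_scope.
Local Open Scope ereal_scope.

Section defs.
Context {R : realType}.

(* Pn is the n-fold product D^n: it agrees with the product of D on all
   measurable rectangles (which determine it uniquely). *)
Definition is_product_measure {d : measure_display} {T : measurableType d} (n : nat)
  (D : probability T R) (Pn : probability (n.-tuple T) R) : Prop :=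
  forall A : 'I_n -> set T, (forall i, measurable (A i)) ->
    Pn [set x | forall i, A i (tnth x i)] = (\prod_(i < n) fine (D (A i)))%:E.

Definition pop_mean {d : measure_display} {S : measurableType d}
  (P : probability S R) (f : S -> R) : R := Rintegral P setT f.

Definition subgaussian_centered {d : measure_display} {S : measurableType d}
  (P : probability S R) (sigma : R) (f : S -> R) : Prop :=
  P.-integrable setT (fun x => (f x)%:E) /\
  forall t : R, \int[P]_x (expR (t * (f x - pop_mean P f)))%:E
                <= (expR (t ^+ 2 * sigma ^+ 2 / 2))%:E.

(* KL divergence KL(nu || mu) (nats): \int f ln f dmu where f is a density
   d nu / d mu; +oo if no density exists (all densities agree mu-a.e.). *)
Definition KL {d : measure_display} {S : measurableType d}
  (nu mu : set S -> \bar R) : \bar R :=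
  ereal_inf [set \int[mu]_x (f x * ln (f x))%:E | f in
    [set f : S -> R | measurable_fun setT f /\ (forall x, 0 <= f x)%R /\
       forall A, measurable A -> nu A = \int[mu]_(x in A) (f x)%:E]].

Definition joint_law {d d' : measure_display} {S : measurableType d}
  {Y : measurableType d'} (P : probability S R) (k : R.-pker S ~> Y)
  : set (S * Y) -> \bar R :=
  fun A => \int[P]_x k x (xsection A x).

Definition output_law {d d' : measure_display} {S : measurableType d}
  {Y : measurableType d'} (P : probability S R) (k : R.-pker S ~> Y)
  : set Y -> \bar R :=
  fun B => \int[P]_x k x B.

Definition indep_law {d d' : measure_display} {S : measurableType d}
  {Y : measurableType d'} (P : probability S R) (k : R.-pker S ~> Y)
  : set (S * Y) -> \bar R :=
  fun A => \int[P]_x output_law P k (xsection A x).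

Definition mutual_info {d d' : measure_display} {S : measurableType d}
  {Y : measurableType d'} (P : probability S R) (k : R.-pker S ~> Y) : \bar R :=
  KL (joint_law P k) (indep_law P k).

End defs.

(* Main.v *)
(* Relative to the product of the marginals, integrating the subgaussian bound
   against a standard Gaussian in t gives
   E exp(l (phi(X) - phi(D^n))^2 / (2 sigma^2)) <= 1 / sqrt(1 - l), and the
   Donsker-Varadhan inequality transfers this to the joint law of X and M(X)
   at the cost of the mutual information. *)
Require Import Defs.
From HB Require Import structures.
From mathcomp Require Import all_boot all_order all_algebra.
From mathcomp Require Import all_classical all_reals all_analysis.
From mathcomp Require Import measurable_realfun.
From mathcomp Require Import ring lra.
Import Order.TTheory GRing.Theory Num.Theory.
Local Open Scope classical_set_scope.
Local Open Scope ring_scope.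
Local Open Scope ereal_scope.

(** * Exponential moments and the variational bound on relative entropy *)

(** Fenchel-Young for the conjugate pair [x ln x - x] and [expR]: for positive [x], multiply
    [1 + u <= expR u] at [u = y - ln x] by [x]. *)
Lemma young_xlnx {R : realType} (x y : R) :
  (0 <= x -> x * y + x <= x * ln x + expR y)%R.
Proof.
rewrite le_eqVlt => /predU1P[<-|x0]; first by rewrite !mul0r !add0r expR_ge0.
have /(ler_wpM2l (ltW x0)) := expR_ge1Dx (y - ln x).
rewrite expRD expRN lnK ?posrE// mulrCA divff ?gt_eqF// mulr1.
by lra.
Qed.

(** Completing the square: an exponential tilt of the standard Gaussian shifts its mean to [b]. *)
Lemma normal_pdf_expR {R : realType} (b t : R) :
  (normal_pdf 0 1 t * expR (b * t) = expR (b ^+ 2 / 2) * normal_pdf b 1 t)%R.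
Proof.
rewrite !normal_pdfE ?oner_eq0// /normal_fun -mulrA mulrCA [RHS]mulrCA.
rewrite -mulrCA mulrC [RHS]mulrC; congr (_ * _)%R; rewrite -!expRD.
by congr expR; field.
Qed.

(** The factor turns the exponent into [- (1 - l) * t ^+ 2 / 2], a centred Gaussian of variance
    [1 / (1 - l)]; the constant is the ratio of the two peaks. *)
Lemma normal_pdf_expR_sqr {R : realType} (l t : R) : (l < 1)%R ->
  (normal_pdf 0 1 t * expR (l * t ^+ 2 / 2) =
   (Num.sqrt (1 - l))^-1 * normal_pdf 0 (Num.sqrt (1 - l))^-1 t)%R.
Proof.
move=> l1; have s0 : (0 < Num.sqrt (1 - l))%R by rewrite sqrtr_gt0 subr_gt0.
have sE : (Num.sqrt (1 - l) ^+ 2 = 1 - l)%R.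
  by rewrite sqr_sqrtr// subr_ge0 ltW.
rewrite !normal_pdfE ?oner_eq0 ?invr_neq0 ?gt_eqF// /normal_fun /normal_peak.
rewrite -[LHS]mulrA -expRD [RHS]mulrA.
set s := Num.sqrt (1 - l).
have -> : (s^-1 * (Num.sqrt (s^-1 ^+ 2 * pi *+ 2))^-1 =
    (Num.sqrt (1 ^+ 2 * pi *+ 2))^-1 :> R)%R.
  rewrite expr1n mul1r -mulrnAr sqrtrM ?sqr_ge0// sqrtr_sqr.
  rewrite gtr0_norm ?invr_gt0//.
  by rewrite invfM invrK mulKf// gt_eqF.
congr (_ * expR _)%R; rewrite exprVn sE; field.
by rewrite lt0r_neq0 ?subr_gt0.
Qed.

Lemma integral_normal_pdf_expR {R : realType} (b : R) :
  \int[lebesgue_measure]_t (normal_pdf 0 1 t * expR (b * t))%:E =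
  (expR (b ^+ 2 / 2))%:E.
Proof.
under eq_integral do rewrite normal_pdf_expR EFinM.
rewrite ge0_integralZl ?integral_normal_pdf ?mule1 ?lee_fin ?expR_ge0//.
  by apply/measurable_EFinP; exact: measurable_normal_pdf.
by move=> t _; rewrite lee_fin normal_pdf_ge0.
Qed.

Lemma integral_normal_pdf_expR_sqr {R : realType} (l : R) : (l < 1)%R ->
  \int[lebesgue_measure]_t (normal_pdf 0 1 t * expR (l * t ^+ 2 / 2))%:E =
  (Num.sqrt (1 - l))^-1%:E.
Proof.
move=> l1; under eq_integral do rewrite normal_pdf_expR_sqr// EFinM.
rewrite ge0_integralZl ?integral_normal_pdf ?mule1 ?lee_fin ?invr_ge0//.
  by apply/measurable_EFinP; exact: measurable_normal_pdf.
by move=> t _; rewrite lee_fin normal_pdf_ge0.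
Qed.

Lemma subgaussian_expR_sqr {R : realType} {d : measure_display}
    {S : measurableType d} (P : probability S R) (Z : S -> R) (sigma l : R) :
  measurable_fun setT Z -> (0 < sigma)%R -> (0 < l < 1)%R ->
  (forall t : R, \int[P]_x (expR (t * Z x))%:E
                 <= (expR (t ^+ 2 * sigma ^+ 2 / 2))%:E) ->
  \int[P]_x (expR (l * Z x ^+ 2 / (2 * sigma ^+ 2)))%:E
    <= (Num.sqrt (1 - l))^-1%:E.
Proof.
move=> mZ s0 /andP[l0 l1] subZ.
(* With this scale, averaging [expR (a * Z * t)] over a standard Gaussian [t] gives the exponent
   [l * Z ^+ 2 / (2 * sigma ^+ 2)], while the subgaussian bound at [a * t] becomes
   [expR (l * t ^+ 2 / 2)]. *)
pose a : R := (Num.sqrt l / sigma)%R.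
have a2 : (a ^+ 2 = l / sigma ^+ 2)%R by rewrite expr_div_n sqr_sqrtr// ltW.
pose h (p : S * R) : \bar R := (normal_pdf 0 1 p.2 * expR (a * Z p.1 * p.2))%:E.
have h0 p : 0 <= h p by rewrite lee_fin mulr_ge0 ?normal_pdf_ge0 ?expR_ge0.
have mh : measurable_fun setT h.
  apply/measurable_EFinP/measurable_funM.
    exact: measurableT_comp (measurable_normal_pdf _ _) measurable_snd.
  apply: measurableT_comp => //; apply: measurable_funM => //.
  by apply: measurable_funM => //; exact: measurableT_comp mZ measurable_fst.
have -> : \int[P]_x (expR (l * Z x ^+ 2 / (2 * sigma ^+ 2)))%:E =
    \int[P]_x \int[lebesgue_measure]_t h (x, t).
  apply: eq_integral => x _.
  transitivity (expR ((a * Z x) ^+ 2 / 2))%:E.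
    by rewrite exprMn a2; congr (expR _)%:E; field; rewrite gt_eqF.
  by rewrite -integral_normal_pdf_expR.
(* After the exchange [t] is fixed in the inner integral, so the subgaussian bound applies pointwise
   in [t]. *)
rewrite fubini_tonelli// -integral_normal_pdf_expR_sqr//.
apply: ge0_le_integral => //.
- by move=> t _; exact: integral_ge0.
- exact: measurable_fun_fubini_tonelli_G.
- apply/measurable_EFinP/measurable_funM; first exact: measurable_normal_pdf.
  by apply: measurableT_comp => //; apply: measurable_funM => //;
    apply: measurable_funM => //; exact: measurable_funX.
move=> t _; rewrite /h /=; under eq_integral do rewrite EFinM mulrAC.
rewrite ge0_integralZl//; last 2 first.
- by apply/measurable_EFinP/measurableT_comp => //; exact: measurable_funM.
- by rewrite lee_fin normal_pdf_ge0.
rewrite EFinM lee_wpmul2l ?lee_fin ?normal_pdf_ge0//.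
apply: le_trans (subZ _) _; rewrite lee_fin ler_expR exprMn a2.
by rewrite le_eqVlt; apply/orP; left; apply/eqP; field; rewrite gt_eqF.
Qed.

(* All terms are kept nonnegative, so that only the negative part of [f ln f],
   which is bounded by 1, has to be cancelled. *)
Lemma donsker_varadhan {R : realType} {d : measure_display}
    {S : measurableType d} (mu : {measure set S -> \bar R})
    (f g : S -> R) (c : R) :
  measurable_fun setT f -> (forall x, 0 <= f x)%R ->
  \int[mu]_x (f x)%:E = 1 ->
  measurable_fun setT g -> (forall x, 0 <= g x)%R ->
  (0 <= c)%R -> \int[mu]_x (expR (g x))%:E <= (expR c)%:E ->
  \int[mu]_x (f x * g x)%:E <= \int[mu]_x (f x * ln (f x))%:E + c%:E.
Proof.
move=> mf f0 intf mg g0 c0 intg.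
pose h x : \bar R := (f x * ln (f x))%:E.
have mh : measurable_fun setT h.
  by apply/measurable_EFinP/measurable_funM => //; exact: measurableT_comp.
have meg : measurable_fun setT (fun x => (expR (g x))%:E).
  by apply/measurable_EFinP; exact: measurableT_comp.
have mfg : measurable_fun setT (fun x => (f x * g x)%:E).
  by apply/measurable_EFinP/measurable_funM.
have fg0 x : 0 <= (f x * g x)%:E by rewrite lee_fin mulr_ge0.
(* [young_xlnx] at [y = 0] gives [- x ln x <= 1 - x <= 1]. Since [mu] may be infinite, the constant
   1 is replaced by [expR (g x)], whose integral is finite. *)
have hn x : h^\- x <= (expR (g x))%:E.
  rewrite funenegE /h -EFin_max lee_fin ge_max expR_ge0 andbT.
  have := young_xlnx (f x) 0 (f0 x); have := f0 x.
  have : (1 <= expR (g x))%R by rewrite -expR0 ler_expR.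
  by rewrite mulr0 expR0; lra.
have Hn : \int[mu]_x h^\- x \is a fin_num.
  rewrite ge0_fin_numE ?integral_ge0//.
  apply: (@le_lt_trans _ _ (expR c)%:E); last exact: ltry.
  apply: le_trans intg; apply: ge0_le_integral => //.
  exact: measurable_funeneg.
have mhp := measurable_funepos mh; have mhn := measurable_funeneg mh.
have mf' : measurable_fun setT (fun x => (f x)%:E) by exact/measurable_EFinP.
(* Young's inequality at [g x - c], with negative terms moved across. The shift by [c] makes the
   exponential term integrate to at most 1, which cancels against the integral of [f]. *)
have young x : (f x * g x)%:E + ((f x)%:E + h^\- x) <=
    h^\+ x + (c%:E * (f x)%:E + (expR (- c))%:E * (expR (g x))%:E).
  have := young_xlnx (f x) (g x - c) (f0 x).
  rewrite funeposE funenegE /h -!EFin_max -!EFinM -!EFinD.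
  rewrite lee_fin expRD mulrBr [(expR (g x) * _)%R]mulrC [(c * _)%R]mulrC.
  rewrite /Num.max; do 2 case: ifPn; rewrite -?leNgt; lra.
have : \int[mu]_x (f x * g x)%:E + (1 + \int[mu]_x h^\- x) <=
    \int[mu]_x h^\+ x + (c%:E + 1).
  have f0' x : 0 <= (f x)%:E by rewrite lee_fin.
  have eg0 x : 0 <= (expR (g x))%:E by rewrite lee_fin expR_ge0.
  have c0' : 0 <= c%:E by rewrite lee_fin.
  have ec0 : 0 <= (expR (- c))%:E by rewrite lee_fin expR_ge0.
  have mcf : measurable_fun setT (fun x => c%:E * (f x)%:E).
    exact: measurable_funeM.
  have mceg : measurable_fun setT (fun x => (expR (- c))%:E * (expR (g x))%:E).
    exact: measurable_funeM.
  have cf0 x : 0 <= c%:E * (f x)%:E by rewrite mule_ge0.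
  have ceg0 x : 0 <= (expR (- c))%:E * (expR (g x))%:E by rewrite mule_ge0.
  have := ge0_le_integral mu measurableT.
  move=> /(_ _ _ _ _ _ (fun x _ => young x)).
  have mfhn : measurable_fun setT (fun x => (f x)%:E + h^\- x).
    exact: emeasurable_funD.
  have fhn0 x : 0 <= (f x)%:E + h^\- x by rewrite adde_ge0.
  have mceg' : measurable_fun setT
      (fun x => c%:E * (f x)%:E + (expR (- c))%:E * (expR (g x))%:E).
    exact: emeasurable_funD.
  have ceg0' x : 0 <= c%:E * (f x)%:E + (expR (- c))%:E * (expR (g x))%:E.
    by rewrite adde_ge0.
  rewrite !ge0_integralD//.
  rewrite !ge0_integralZl// intf mule1 => le_int.
  apply: le_trans (le_int _ _ _) _.
  - by move=> x _; rewrite adde_ge0.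
  - exact: emeasurable_funD.
  - exact: emeasurable_funD.
  rewrite leeD2l// leeD2l//.
  rewrite (le_trans (lee_wpmul2l _ intg))// ?lee_fin ?expR_ge0//.
  by rewrite -expRD addNr expR0.
(* The integral of [f ln f] is by definition the difference of those of [h^\+] and [h^\-]; the
   latter is finite by [Hn], so it can be subtracted. *)
rewrite [X in _ -> _ <= X + _]integralE.
move: Hn; set F := \int[mu]_x (f x * g x)%:E.
move: (\int[mu]_x h^\- x) (\int[mu]_x h^\+ x) F => [N| |] [Q| |] [F| |] _ //=;
  rewrite ?lee_fin ?leey ?leNye//; lra.
Qed.

(** * Integration against a density and against the joint law *)

(** The change of variables holds for the Radon-Nikodym derivative, and [f], having the same
    integrals over measurable sets, equals it [mu]-almost everywhere. *)
Lemma ge0_integral_density {R : realType} {d : measure_display}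
    {S : measurableType d} (nu : {finite_measure set S -> \bar R})
    (mu : {sigma_finite_measure set S -> \bar R}) (f g : S -> \bar R) :
  measurable_fun setT f -> (forall x, 0 <= f x) ->
  (forall A, measurable A -> nu A = \int[mu]_(x in A) f x) ->
  measurable_fun setT g -> (forall x, 0 <= g x) ->
  \int[nu]_x g x = \int[mu]_x (g x * f x).
Proof.
move=> mf f0 nuf mg g0.
have numu : nu `<< mu.
  apply/null_content_dominatesP => A mA A0.
  by rewrite nuf// null_set_integral// /= ?A0//; exact: measurable_funTS.
rewrite -(Radon_Nikodym_SigmaFinite.change_of_variables numu)//.
have RNi := Radon_Nikodym_SigmaFinite.f_integrable numu.
have RN0 := Radon_Nikodym_SigmaFinite.f_ge0 numu.
have mRN := measurable_int _ RNi.
apply: ge0_ae_eq_integral => //.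
- exact: emeasurable_funM.
- exact: emeasurable_funM.
- by move=> x _; rewrite mule_ge0.
- by move=> x _; rewrite mule_ge0.
have : ae_eq mu setT (Radon_Nikodym_SigmaFinite.f nu mu) f.
  apply: integral_ae_eq => // A _ mA.
  by rewrite -nuf// -Radon_Nikodym_SigmaFinite.f_integral.
by apply: filterS => x /= /[apply] ->.
Qed.

Lemma xsection_setT {S Y : Type} (x : S) : xsection [set: S * Y] x = setT.
Proof. by rewrite -setXTT in_xsectionX// inE. Qed.

Section joint_measure.
Context {R : realType} {d d' : measure_display} {S : measurableType d}
  {Y : measurableType d'} (P : probability S R) (k : R.-pker S ~> Y).

(* The unit factor only serves to write the joint law as a composition of
   kernels out of a point. *)
Definition graph_kernel (p : unit * S) : {measure set (S * Y) -> \bar R} :=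
  mkcomp k (kdirac (@measurable_id _ (S * Y)%type setT)) p.2.

Lemma graph_kernelE p A : measurable A ->
  graph_kernel p A = k p.2 (xsection A p.2).
Proof.
move=> mA; rewrite /graph_kernel /= /kcomp.
rewrite -[xsection A p.2]setIT -integral_indic//; last first.
  exact: measurable_xsection.
apply: eq_integral => y _ /=; rewrite /kdirac /= diracE indicE.
by rewrite mem_xsection.
Qed.

Let measurable_graph_kernel A : measurable A ->
  measurable_fun [set: unit * S] (graph_kernel ^~ A).
Proof.
move=> mA.
apply: (measurableT_comp (f := fun x => graph_kernel (tt, x) A) (g := snd)) => //.
under eq_fun do rewrite graph_kernelE//.
by apply: measurable_fun_xsection_finite_kernel; rewrite inE.
Qed.

HB.instance Definition _ :=
  isKernel.Build _ _ _ _ _ graph_kernel measurable_graph_kernel.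

Let graph_kernel_setT p : graph_kernel p setT = 1.
Proof. by rewrite graph_kernelE// (xsection_setT p.2) prob_kernel. Qed.

HB.instance Definition _ :=
  Kernel_isProbability.Build _ _ _ _ _ graph_kernel graph_kernel_setT.

Let const_kernel : R.-pker unit ~> S :=
  kprobability (@measurable_cst _ _ unit (pprobability S R) setT P).

(** A genuine measure standing in for the bare set function [joint_law]; agreement on measurable
    sets suffices, as [KL] tests only those. *)
Definition joint_prob : set (S * Y) -> \bar R :=
  mkcomp const_kernel graph_kernel tt.

HB.instance Definition _ := Measure.on joint_prob.

Lemma joint_probE A : measurable A -> joint_prob A = joint_law P k A.
Proof.
move=> mA; rewrite /joint_prob /= /kcomp /joint_law.
by apply: eq_integral => x _; rewrite graph_kernelE.
Qed.

Let joint_prob_setT : joint_prob setT = 1.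
Proof.
rewrite /joint_prob /= /kcomp.
under eq_integral do rewrite graph_kernelE// xsection_setT prob_kernel.
by rewrite integral_cst// mul1e prob_kernel.
Qed.

HB.instance Definition _ :=
  Measure_isProbability.Build _ _ _ joint_prob joint_prob_setT.

(* Unlike [joint_prob], [output_law] must itself be a measure, since
   [indep_law] evaluates it on sections of arbitrary sets. *)
Definition snd_kernel (p : unit * S) : {measure set Y -> \bar R} := k p.2.

Let measurable_snd_kernel A : measurable A ->
  measurable_fun [set: unit * S] (snd_kernel ^~ A).
Proof.
move=> mA.
exact: (measurableT_comp (measurable_kernel k A mA) measurable_snd).
Qed.

HB.instance Definition _ :=
  isKernel.Build _ _ _ _ _ snd_kernel measurable_snd_kernel.

HB.instance Definition _ :=
  Measure.copy (output_law P k) (mkcomp const_kernel snd_kernel tt).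

Let output_law_setT : output_law P k setT = 1.
Proof.
rewrite /output_law; under eq_integral do rewrite prob_kernel.
by rewrite integral_cst//= probability_setT mule1.
Qed.

HB.instance Definition _ :=
  Measure_isProbability.Build _ _ _ (output_law P k) output_law_setT.

Lemma ge0_integral_joint_prob (g : S * Y -> \bar R) :
  (forall z, 0 <= g z) -> measurable_fun setT g ->
  \int[joint_prob]_z g z = \int[P]_x \int[k x]_y g (x, y).
Proof.
move=> g0 mg; rewrite /joint_prob /= integral_kcomp//.
apply: eq_integral => x _; rewrite /graph_kernel integral_kcomp//.
by apply: eq_integral => y _; rewrite integral_dirac// diracT mul1e.
Qed.

End joint_measure.

Lemma measurable_pop_mean {R : realType} {d d' : measure_display}
    {S : measurableType d} {Y : measurableType d'} (P : probability S R)
    (phi : Y -> S -> R) :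
  measurable_fun setT (fun p : Y * S => phi p.1 p.2) ->
  measurable_fun setT (fun y => pop_mean P (phi y)).
Proof.
move=> mphi; rewrite /pop_mean /Rintegral.
apply: measurableT_comp => //.
(* Tonelli's measurability of partial integrals concerns nonnegative integrands, hence the split
   into positive and negative parts. *)
under eq_fun do rewrite integralE.
pose h (p : Y * S) : \bar R := (phi p.1 p.2)%:E.
have mh : measurable_fun setT h by exact/measurable_EFinP.
apply: emeasurable_funB.
- rewrite (_ : (fun y => _) = fubini_F P h^\+); last first.
    by apply/funext => y; apply: eq_integral => x _; rewrite !funeposE.
  apply: measurable_fun_fubini_tonelli_F => //; exact: measurable_funepos.
- rewrite (_ : (fun y => _) = fubini_F P h^\-); last first.
    by apply/funext => y; apply: eq_integral => x _; rewrite !funenegE.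
  apply: measurable_fun_fubini_tonelli_F => //; exact: measurable_funeneg.
Qed.

(** * The deviation bound at a fixed [l], then the infimum *)

Lemma mutual_info_sqr_deviation {R : realType} {d d' : measure_display}
    {S : measurableType d} {Y : measurableType d'} (P : probability S R)
    (k : R.-pker S ~> Y) (phi : Y -> S -> R) (sigma B l : R) :
  (0 < sigma)%R -> (0 < l < 1)%R ->
  measurable_fun setT (fun p : Y * S => phi p.1 p.2) ->
  (forall y, subgaussian_centered P sigma (phi y)) ->
  mutual_info P k <= B%:E ->
  \int[P]_x \int[k x]_y ((phi y x - pop_mean P (phi y)) ^+ 2)%:E
    <= (sigma ^+ 2 * ((2 * B - ln (1 - l)) / l))%:E.
Proof.
move=> s0 l01 mphi subphi IB; have /andP[l0 l1] := l01.
pose G (p : S * Y) : R := ((phi p.2 p.1 - pop_mean P (phi p.2)) ^+ 2)%R.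
have G0 p : (0 <= G p)%R by exact: sqr_ge0.
have mG : measurable_fun setT G.
  apply: measurable_funX; apply: measurable_funB.
    exact: (measurableT_comp mphi (measurable_swap (T1 := S) (T2 := Y))).
  exact: (measurableT_comp (measurable_pop_mean P phi mphi) measurable_snd).
pose a : R := (l / (2 * sigma ^+ 2))%R.
have a0 : (0 < a)%R by rewrite divr_gt0// mulr_gt0// exprn_gt0.
pose r : R := (Num.sqrt (1 - l))^-1%R.
(* This makes [ln r] nonnegative, as the constant [c] of [donsker_varadhan] must be. *)
have r1 : (1 <= r)%R.
  rewrite invf_ge1 ?sqrtr_gt0 ?subr_gt0// -[leRHS]sqrtr1 ler_sqrt//.
  by rewrite gerBl ltW.
have r0 : (0 < r)%R by exact: lt_le_trans r1.
pose Q : probability Y R := output_law P k.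
(* [indep_law P k] is convertible to this product, so the densities quantified over in [KL] are
   densities with respect to [mu]. *)
pose mu : probability (S * Y)%type R := P \x Q.
have intG : \int[mu]_z (expR (a * G z))%:E <= (expR (ln r))%:E.
  have meG : measurable_fun setT (fun z => (expR (a * G z))%:E).
    by apply/measurable_EFinP/measurableT_comp => //; exact: measurable_funM.
  have eG0 z : 0 <= (expR (a * G z))%:E by rewrite lee_fin expR_ge0.
  (* The output [y] goes outermost: under the product measure the inner variable keeps law [P] for
     each fixed [y], where [phi y] is subgaussian. *)
  rewrite lnK ?posrE// fubini_tonelli2//.
  apply: (@le_trans _ _ (\int[Q]_y r%:E)); last first.
    by rewrite integral_cst//= probability_setT mule1.
  apply: ge0_le_integral => //.
  - by move=> y _; exact: integral_ge0.
  - exact: measurable_fun_fubini_tonelli_G.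
  move=> y _; have [phiy suby] := subphi y.
  apply: le_trans (subgaussian_expR_sqr P _ sigma l _ s0 l01 suby); last first.
    apply: measurable_funB => //; apply/measurable_EFinP.
    exact: measurable_int phiy.
  by under eq_integral do rewrite /G /= /a mulrAC.
pose T := \int[P]_x \int[k x]_y (G (x, y))%:E.
have T0 : 0 <= T.
  by apply: integral_ge0 => x _; apply: integral_ge0 => y _; rewrite lee_fin.
have : a%:E * T - (ln r)%:E <= B%:E.
  (* As [KL] is an infimum over densities, it is enough to bound the value at an arbitrary density
     [f] from below. *)
  apply: le_trans IB; apply: le_ereal_inf_tmp => _ [f [mf [f0 fE]] <-].
  rewrite leeBlDr//.
  have mf' : measurable_fun setT (fun z => (f z)%:E) by exact/measurable_EFinP.
  have fJ A : measurable A -> joint_prob P k A = \int[mu]_(z in A) (f z)%:E.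
    by move=> mA; rewrite joint_probE// fE.
  have -> : a%:E * T = \int[mu]_z (f z * (a * G z))%:E.
    have -> : T = \int[joint_prob P k]_z (G z)%:E.
      by rewrite ge0_integral_joint_prob//; exact/measurable_EFinP.
    transitivity (\int[joint_prob P k]_z (a%:E * (G z)%:E)).
      apply/esym/ge0_integralZl; [exact: measurableT| | |].
      - exact/measurable_EFinP.
      - by move=> z _; rewrite lee_fin.
      - by rewrite lee_fin ltW.
    rewrite (@ge0_integral_density _ _ _ (joint_prob P k) mu _ _ mf' _ fJ).
    - by apply: eq_integral => z _; rewrite -!EFinM mulrC.
    - by move=> z; rewrite lee_fin.
    - exact/measurable_funeM/measurable_EFinP.
    - by move=> z; rewrite mule_ge0 ?lee_fin// ltW.
  apply: (@donsker_varadhan _ _ _ mu) => //.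
  - by rewrite -fJ// probability_setT.
  - exact: measurable_funM.
  - by move=> z; rewrite mulr_ge0// ltW.
  - exact: ln_ge0.
have -> : (ln r = - ln (1 - l) / 2)%R.
  rewrite lnV ?posrE ?sqrtr_gt0 ?subr_gt0// -powR12_sqrt ?subr_ge0 ?ltW//.
  by rewrite ln_powR mulrC mulNr.
(* An infinite [T] would make the left side [+oo], because [a] is positive, contradicting the real
   bound [B]. *)
rewrite -/T; case: T T0 => [t| |]//= t0; last by rewrite gt0_muley.
rewrite -EFinM -EFinB !lee_fin => aB.
have {aB} : (a * t <= B - ln (1 - l) / 2)%R by lra.
rewrite -ler_pdivlMl// => /le_trans; apply.
rewrite le_eqVlt; apply/orP; left; apply/eqP.
by rewrite /a; field; rewrite !gt_eqF.
Qed.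

Theorem mainTheorem4 (R : realType) (d dY : measure_display)
  (T : measurableType d) (Y : measurableType dY) (n : nat)
  (D : probability T R) (Pn : probability (n.-tuple T) R)
  (sigma B : R)
  (phi : Y -> n.-tuple T -> R) (M : R.-pker (n.-tuple T) ~> Y) :
  is_product_measure D Pn ->
  (0 < sigma)%R ->
  measurable_fun setT (fun p : Y * n.-tuple T => phi p.1 p.2) ->
  (forall y : Y, subgaussian_centered Pn sigma (phi y)) ->
  mutual_info Pn M <= B%:E ->
  \int[Pn]_x \int[M x]_y ((phi y x - pop_mean Pn (phi y)) ^+ 2)%:E
    <= (sigma ^+ 2)%:E *
       ereal_inf [set ((2 * B - ln (1 - lam)) / lam)%:E | lam in `]0%R, 1%R[].
Proof.
move=> _ s0 mphi subphi IB; have s20 : (0 < sigma ^+ 2)%R by rewrite exprn_gt0.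
(* Dividing by [sigma ^+ 2] isolates the infimum, so each [l] can be treated separately. *)
rewrite -lee_pdivrMl//; apply: le_ereal_inf_tmp => _ [l /= l01 <-].
rewrite lee_pdivrMl// -EFinM.
exact: mutual_info_sqr_deviation.
Qed.
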